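(* Every $b_\sigma$-flavoured space $X$ is $\mu^{\#}_{cc}$-complete; that is, every relatively countably compact subset of $C_p(X)$ has compact closure in $C_p(X)$.
   Context: All spaces are Tychonoff. $C_p(X)$ is the space of continuous real-valued functions on $X$ with the topology of pointwise convergence; for $M\subset X$, $C_p(X|M)=\{f|_M: f\in C_p(X)\}\subset\mathbb R^M$. A subset $Z$ of a space $T$ is relatively countably compact in $T$ if every sequence in $Z$ has an accumulation point in $T$. A subset $P$ of $X$ is bounded in $X$ if every continuous function $X\to\mathbb R$ is bounded on $P$; it is $\sigma$-bounded if it is a countable union of sets bounded in $X$. $\mathcal P_b(X)$ is the family of all $M\subset X$ such that some $\sigma$-bounded subset of $X$ is contained and dense in $M$. A family $\mathcal M$ of subspaces of $X$ with $\bigcup\mathcal M=X$ functionally generates $X$ if a function $f\in\mathbb R^X$ is continuous if and only if $f|_M\in C_p(X|M)$ for every $M\in\mathcal M$. The space $X$ is $b_\sigma$-flavoured if it is functionally generated by $\mathcal P_b(X)$. *)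

(* Defs.v *)
From HB Require Import structures.
From mathcomp Require Import all_boot all_order all_algebra.
From mathcomp Require Import all_classical all_reals all_analysis.
Import numFieldNormedType.Exports.

Set Implicit Arguments.
Unset Strict Implicit.
Unset Printing Implicit Defensive.

Local Open Scope classical_set_scope.
Local Open Scope ring_scope.

(* The library phrases complete regularity with a coarser uniformity;
   [uniform_separatorP] restates it with continuous functions into [0, 1]. *)
Definition tychonoff_space (X : topologicalType) : Prop :=
  completely_regular_space X /\ accessible_space X.

(* $C_p(X)$, with the topology that [ArrowAsProduct] gives to [continuousType];
   importing that module would also put a topology on every arrow type. *)
Definition Cp (R : realType) (X : topologicalType) : topologicalType :=
  initial_topology
    ((fun f => f : X -> R) : continuousType X R -> {ptws X -> R}).

(* $C_p(X|M)$, as a set of functions on the subtype of [M]. *)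
Definition Cp_restr (R : realType) (X : topologicalType) (M : set X) :
    set (M -> R) :=
  [set sigL M (f : continuousType X R) | f in [set: Cp R X]].
Arguments Cp_restr : clear implicits.

(* [cluster (u @ \oo)] is the set of accumulation points of the sequence [u]:
   the points all of whose neighbourhoods contain [u n] for infinitely
   many [n]. *)
Definition relatively_countably_compact (T : topologicalType) (Z : set T) :
    Prop :=
  forall u : nat -> T, (forall n, Z (u n)) -> cluster (u @ \oo) !=set0.

Definition bounded_in (R : realType) (X : topologicalType) (P : set X) : Prop :=
  forall f : X -> R, continuous f -> [bounded f x | x in P].

Definition sigma_bounded_in (R : realType) (X : topologicalType) (P : set X) :
    Prop :=
  exists2 B : nat -> set X,
    forall n, bounded_in R (B n) & P = \bigcup_n B n.

(* Density in [M] is for the subspace topology, carried here by the subtype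
   of [M]; the type [subspace M] of the library has the same points as [X]
   and would not do. *)
Definition P_b (R : realType) (X : topologicalType) : set (set X) :=
  [set M | exists S : set X,
     [/\ sigma_bounded_in R S, S `<=` M &
         dense (set_val @^-1` S : set (set_type M))]].
Arguments P_b : clear implicits.

Definition functionally_generates (R : realType) (X : topologicalType)
    (F : set (set X)) : Prop :=
  \bigcup_(M in F) M = [set: X] /\
  forall f : X -> R,
    continuous f <-> forall M : set X, F M -> Cp_restr R X M (sigL M f).

Definition b_sigma_flavoured (R : realType) (X : topologicalType) : Prop :=
  functionally_generates R (P_b R X).

Definition mu_cc_complete (R : realType) (X : topologicalType) : Prop :=
  forall Z : set (Cp R X),
    relatively_countably_compact Z -> compact (closure Z).

(* Main.v *)
Require Import Defs.
From mathcomp Require Import all_boot all_order all_algebra.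
From mathcomp Require Import all_classical all_reals all_analysis.
From mathcomp Require Import lra.
Import Order.TTheory GRing.Theory Num.Theory numFieldNormedType.Exports.

Set Implicit Arguments.
Unset Strict Implicit.
Unset Printing Implicit Defensive.

Local Open Scope classical_set_scope.
Local Open Scope ring_scope.

(* Grothendieck's double limit argument.  Let phi be the pointwise limit of an
   ultrafilter on the closure of Z, and let S = \bigcup_j B_j with every B_j
   bounded.  One picks u_n in Z converging to phi on a countable set that is
   dense in every B_j for the pseudometrics given by phi and finitely many u_n.
   If g is an accumulation point of (u_n) and x is in B_j, then, B_j being
   bounded, some z satisfies u_n z = u_n x for all n and g z = phi x; since g
   clusters (u_n) at x and z simultaneously, g x = g z = phi x.  So phi agrees
   with a continuous function on S, and likewise on S together with one more
   point; if S is dense in M, this gives phi = g on M. *)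

(** * Common zeros from bounded sets; countable approximation *)

Lemma exists_inv_succ_lt (R : realType) (e : R) :
  0 < e -> exists N, N.+1%:R^-1 < e.
Proof.
move=> e0; have [N _ /(_ N (leqnn N)) /=] := near_infty_natSinv_lt (PosNum e0).
by exists N.
Qed.

Lemma min_le_dist (R : realType) (r u v e : R) :
  `|v - u| < e -> Num.min `|u| r <= Num.min `|v| r + e.
Proof.
move=> vue; have := lerB_dist u v; have := normr_ge0 (u - v).
move: vue; rewrite distrC.
by case: (leP `|u| r) => ?; case: (leP `|v| r) => ?; lra.
Qed.

(** Boundedness stands in for compactness: approximate common zeros in [B] force an exact one,
    though possibly outside [B]. *)
Lemma bounded_in_common_zero (R : realType) (X : topologicalType) (B : set X)
    (a : nat -> X -> R) :
  bounded_in R B -> (forall i, continuous (a i)) ->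
  (forall n (e : R), 0 < e ->
     exists2 y, B y & forall i, (i < n)%N -> `|a i y| < e) ->
  exists z, forall i, a i z = 0.
Proof.
move=> Bbnd ca small; apply: contrapT => /forallNP nz.
(* Otherwise F = sup_i min(|a_i|, 1/(i+1)) is continuous and positive, and 1/F
   is unbounded on B. *)
pose m i z : R := Num.min `|a i z| i.+1%:R^-1.
pose F z : R := sup (range (m ^~ z)).
have ub z : has_ubound (range (m ^~ z)).
  exists 1 => _ [i _ <-]; rewrite /m ge_min; apply/orP; right.
  by rewrite invf_le1 ?ler1n.
have mF i z : m i z <= F z by apply: ub_le_sup => //; exists i.
have Fle z (c : R) : (forall i, m i z <= c) -> F z <= c.
  by move=> h; apply: ge_sup => [|_ [i _ <-]//]; exists (m 0%N z), 0%N.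
have F0 z : 0 < F z.
  have /existsNP[i /eqP aiz] := nz z; apply: lt_le_trans (mF i z).
  by rewrite /m lt_min normr_gt0 aiz invr_gt0 ltr0n.
(* Truncation keeps the terms of index above [N] below [e], so finitely many [a i] control [F];
   continuity of [F] and its smallness on [B] both rest on this. *)
have Fsmall N (e : R) y (c : R) : N.+1%:R^-1 < e -> 0 <= c ->
    (forall i, (i < N.+1)%N -> m i y <= c + e) -> F y <= c + e.
  move=> Ne c0 h; apply: Fle => i; have [/h//|Ni] := ltnP i N.+1.
  rewrite /m ge_min; apply/orP; right.
  apply: (@le_trans _ _ N.+1%:R^-1).
    by rewrite lef_pV2 ?posrE // ler_nat leqW.
  by apply: (le_trans (ltW Ne)); rewrite lerDr.
have Fdist N (e : R) y z : 0 < e -> N.+1%:R^-1 < e ->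
    (forall i, (i < N.+1)%N -> `|a i z - a i y| < e) -> F y <= F z + e.
  move=> e0 Ne h; apply: (Fsmall N) => //; first exact/ltW/F0.
  move=> i /h h'; apply: le_trans (@min_le_dist _ i.+1%:R^-1 _ _ _ h') _.
  by rewrite lerD2r; exact: mF.
have cF : continuous F.
  move=> z; apply/cvgrPdist_le => e e0; have [N Ne] := exists_inv_succ_lt e0.
  have : \forall y \near z, forall i : 'I_N.+1, `|a i z - a i y| < e.
    by apply: filter_forall => i; move/cvgrPdist_lt : (ca i z); apply.
  apply: filterS => y h; rewrite ler_distlC.
  have hi i : (i < N.+1)%N -> `|a i z - a i y| < e.
    by move=> iN; exact: (h (Ordinal iN)).
  have hi' i : (i < N.+1)%N -> `|a i y - a i z| < e.
    by rewrite distrC; apply: hi.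
  by rewrite (Fdist N e y z) // andbT lerBlDr (Fdist N e z y).
have cFV : continuous (fun z => (F z)^-1).
  by move=> z; apply: continuousV; [rewrite gt_eqF | exact: cF].
have /pinfty_ex_gt0[M M0 /= HM] := Bbnd _ cFV.
(* A bound on [F y] strictly below [1/(M+1)] pushes [1/F y] above [M + 1]. *)
have e0 : 0 < (M + 1)^-1 / 2 by rewrite divr_gt0 // invr_gt0; lra.
have [N Ne] := exists_inv_succ_lt e0.
have [y By hy] := small N.+1 _ e0.
have : (F y)^-1 <= M := le_trans (ler_norm _) (HM y By).
rewrite leNgt => /negP; apply.
have Fy : F y <= 0 + (M + 1)^-1 / 2.
  by apply: (Fsmall N) => // i /hy; rewrite add0r /m ge_min => /ltW ->.
have M1 : M < M + 1 by lra.
apply: (lt_trans M1).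
rewrite -[M + 1]invrK ltf_pV2 ?posrE ?invr_gt0 //; last lra.
apply: le_lt_trans Fy _.
have : 0 < (M + 1)^-1 by rewrite invr_gt0; lra.
lra.
Qed.

(** There are countably many rational boxes for the values [F i], [i < n]; one point of [B j] is
    picked in each box that [B j] meets. *)
Lemma countable_dense_choice (R : realType) (X : choiceType) (x0 : X)
    (B : nat -> set X) (n : nat) (F : nat -> X -> R) :
  exists d : nat -> X, forall j x (e : R), B j x -> 0 < e ->
    exists2 k, B j (d k) & forall i, (i < n)%N -> `|F i (d k) - F i x| < e.
Proof.
pose P (t : nat * nat * seq rat) := [set y | B t.1.1 y /\
  forall i, (i < n)%N -> `|F i y - ratr t.2`_i| < t.1.2.+1%:R^-1].
(* [x0] is the default for invalid codes and for boxes that are not met. *)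
exists (fun k => if unpickle k is Some t then xget x0 (P t) else x0).
move=> j x e Bx e0; have e20 : 0 < e / 2 by lra.
have [N Ne] := exists_inv_succ_lt e20.
have N0 : 0 < N.+1%:R^-1 :> R by rewrite invr_gt0.
have ratapp (c r : R) : 0 < r -> exists q : rat, `|c - ratr q| < r.
  move=> r0; have lt : c - r < c + r by lra.
  have [q] := rat_in_itvoo lt; rewrite in_itv /= => /andP[q1 q2]; exists q.
  by rewrite ltr_norml; lra.
have /choice[q hq] i := ratapp (F i x) _ N0.
pose t := (j, N, mkseq q n).
have Px : P t x by split=> //= i ilt; rewrite nth_mkseq.
exists (pickle t); rewrite pickleK;
  case: (xgetPex x0 (ex_intro _ x Px)) => //= _ h i ilt.
have := h i ilt; have := hq i; rewrite nth_mkseq // => h1 h2.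
apply: le_lt_trans (ler_distD (ratr (q i)) _ _) _.
rewrite [`|ratr _ - _|]distrC [e]splitr; apply: ltrD; exact: lt_trans Ne.
Qed.

(** * Evaluations, accumulation points and pointwise limits *)

Definition Cp_eval (R : realType) (X : topologicalType) (x : X)
    (f : Cp R X) : R :=
  (f : continuousType X R) x.

Lemma Cp_eval_continuous (R : realType) (X : topologicalType) (x : X) :
  continuous (@Cp_eval R X x).
Proof.
move=> f; apply: (@continuous_comp (Cp R X) {ptws X -> R} R
  (fun g : continuousType X R => g : X -> R) (@^~ x)).
  exact: initial_continuous.
exact: (@proj_continuous X (fun=> R) x).
Qed.

Lemma Cp_cvg (R : realType) (X : topologicalType) (F : set_system (Cp R X))
    (f : Cp R X) : Filter F ->
  (forall x, Cp_eval x g @[g --> F] --> Cp_eval x f) -> F --> f.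
Proof.
move=> FF cF.
pose G : set_system {ptws X -> R} :=
  ((fun g : continuousType X R => g : X -> R) : Cp R X -> {ptws X -> R}) @ F.
have /(_ FF cF) Gf :=
  (@pointwise_cvgP X R G (f : continuousType X R) (fmap_filter _ _)).2.
move=> A; rewrite nbhsE => -[_ [[C oC <-] Cf] CA].
by apply: filterS CA _; apply: Gf; apply: open_nbhs_nbhs.
Qed.

Lemma nbhs_Cp_eval (R : realType) (X : topologicalType) (f : Cp R X) (s : seq X)
    (e : R) : 0 < e ->
  \forall g \near f, forall x, x \in s -> `|Cp_eval x f - Cp_eval x g| < e.
Proof.
have FF : Filter (nbhs f) := nbhs_filter f.
move=> e0; elim: s => [|y s IH].
  by apply: (@filterS _ _ FF setT) => [g _ x //|]; exact: filterT.
have /cvgrPdist_lt/(_ e e0) H := @Cp_eval_continuous R X y f.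
apply: (@filterS _ _ FF _ _ _ (@filterI _ _ FF _ _ H IH)) => g [hy hs] x.
by rewrite inE => /predU1P[->|/hs].
Qed.

(** A single index serves all points of [s], which later allows values at two points to be
    compared. *)
Lemma cluster_Cp_eval (R : realType) (X : topologicalType) (u : nat -> Cp R X)
    (g : Cp R X) (s : seq X) (e : R) N : cluster (u @ \oo) g -> 0 < e ->
  exists2 n, (N <= n)%N &
    forall x, x \in s -> `|Cp_eval x g - Cp_eval x (u n)| < e.
Proof.
move=> gu e0.
have uN : (u @ \oo) [set u n | n in [set n | (N <= n)%N]].
  by exists N => // n Nn; exists n.
have [_ [[n /= Nn <-] h]] := gu _ _ uN (nbhs_Cp_eval g s e0).
by exists n.
Qed.

(** Compactness of [[-b, b]] gives a cluster point of the image, and an ultrafilter makes it a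
    limit. *)
Lemma ultra_bounded_cvg (R : realType) (T : Type) (F : set_system T)
    (h : T -> R) (b : R) : UltraFilter F -> F [set t | `|h t| <= b] ->
  exists p : R, h @ F --> p.
Proof.
move=> FU Fb.
have Fab : F (h @^-1` `[- b, b]%classic).
  by apply: filterS Fb => t /=; rewrite in_itv /= ler_norml.
have [p [_ cp]] := @segment_compact R (- b) b (h @ F) _ Fab.
exists p => A Ap.
have [//|FC] := in_ultra_setVsetC (h @^-1` A) FU.
by have [q []] := cp (~` A) A FC Ap.
Qed.

Lemma closure_countably_compact_bounded (R : realType) (X : topologicalType)
    (Z : set (Cp R X)) (x : X) : relatively_countably_compact Z ->
  exists b, closure Z `<=` [set f | `|Cp_eval x f| <= b].
Proof.
move=> Zcc.
have [b Zb] : exists b, forall f, Z f -> `|Cp_eval x f| <= b.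
  apply: contrapT => /forallNP nb.
  have /choice[u hu] n : exists f, Z f /\ n%:R < `|Cp_eval x f|.
    have /existsNP[f /not_implyP[Zf /negP]] := nb n%:R.
    by rewrite -ltNge; exists f.
  have [g gu] := Zcc u (fun n => (hu n).1).
  (* So far in the tail, [n] exceeds [|g x| + 1], hence also [|u n x|]. *)
  have [n Nn /(_ x (mem_head _ _)) h] :=
    cluster_Cp_eval [:: x] (Num.truncn (`|Cp_eval x g| + 1)).+1 gu ltr01.
  have := (hu n).2; apply/negP; rewrite -leNgt.
  have h1 : `|Cp_eval x g| + 1 < n%:R.
    by apply: lt_le_trans (truncnS_gt _) _; rewrite ler_nat.
  have := lerB_dist (Cp_eval x (u n)) (Cp_eval x g); rewrite distrC; lra.
exists (b + 1) => f /(_ _ (nbhs_Cp_eval f [:: x] ltr01)) [g [/Zb gb]].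
move=> /(_ x (mem_head _ _)) h /=.
have := lerB_dist (Cp_eval x f) (Cp_eval x g); lra.
Qed.

(** * The double limit argument *)

Lemma eq_dist_lt (R : realType) (a b : R) :
  (forall e, 0 < e -> `|a - b| < e) -> a = b.
Proof.
move=> h; apply/eqP; rewrite -subr_eq0 -normr_le0 leNgt.
by apply/negP => /h; rewrite ltxx.
Qed.

(** Membership in the closure of [Z] in the full product, spelled out because [phi] is not yet known
    to be continuous. *)
Definition pointwise_adherent (R : realType) (X : topologicalType)
    (Z : set (Cp R X)) (phi : X -> R) :=
  forall (s : seq X) (e : R), 0 < e ->
    exists2 f, Z f & forall x, x \in s -> `|Cp_eval x f - phi x| < e.

Lemma adherent_sequence (R : realType) (X : topologicalType) (x0 : X)
    (Z : set (Cp R X)) (phi : X -> R) (B : nat -> set X) :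
  pointwise_adherent Z phi ->
  exists2 u : nat -> Cp R X, forall n, Z (u n) &
    forall j x n (e : R), B j x -> 0 < e ->
      exists y, [/\ B j y,
        forall i, (i < n)%N -> `|Cp_eval y (u i) - Cp_eval x (u i)| < e,
        `|phi y - phi x| < e &
        (fun k => Cp_eval y (u k)) @ \oo --> phi y].
Proof.
move=> Zphi.
(* The default of [nth] appends [phi] at index [size s], hence [(size s).+1] functions below. *)
pose F (s : seq (Cp R X)) := nth phi [seq (fun x => Cp_eval x f) | f <- s].
have /choice[E hE] s := countable_dense_choice x0 B (size s).+1 (F s).
(* Initial points of the sets attached to all prefixes of [s]: every chosen point enters at some
   stage and stays. *)
pose pts s := [seq E (take m s) k | m <- iota 0 (size s).+1,
                                    k <- iota 0 (size s).+1].
have /choice[next hnext] s : exists f, Z f /\ forall x, x \in pts s ->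
    `|Cp_eval x f - phi x| < (size s).+1%:R^-1.
  have [|f Zf fx] := Zphi (pts s) (size s).+1%:R^-1; first by rewrite invr_gt0.
  by exists f.
pose st := fix st n : seq (Cp R X) :=
  if n is n'.+1 then rcons (st n') (next (st n')) else [::].
pose u n : Cp R X := next (st n).
have stE n : st n = mkseq u n by elim: n => //= n IH; rewrite mkseqS -IH.
have sz n : size (st n) = n by rewrite stE; exact: size_mkseq.
have Fphi n : F (st n) n = phi by rewrite /F nth_default // size_map sz.
have Fu n i : (i < n)%N -> F (st n) i = (fun x => Cp_eval x (u i)).
  move=> ilt; rewrite /F (nth_map (u 0%N)) ?sz // stE.
  by rewrite (nth_mkseq (u 0%N) u ilt).
exists u => [n|j x n e Bx e0]; first exact: (hnext _).1.
have [k Bk hk] := hE (st n) j x e Bx e0.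
exists (E (st n) k); split => //.
- by move=> i ilt; have := hk i; rewrite Fu // sz; apply; exact: ltnW.
- by have := hk n; rewrite Fphi sz; apply.
- apply/cvgrPdist_lt => d d0; have [N Nd] := exists_inv_succ_lt d0.
  (* [N] bounds the error; [n] and [k] put the point in [pts (st i)]. *)
  exists (maxn N (maxn n k)) => // i /=; rewrite !geq_max => /and3P[Ni ni ki].
  rewrite distrC; apply: lt_trans ((hnext (st i)).2 _ _) _.
  + have -> : st n = take n (st i).
      by rewrite !stE -map_take take_iota (minn_idPl ni).
    by apply: allpairs_f; rewrite mem_iota sz /= add0n ltnS.
  + by apply: le_lt_trans Nd; rewrite sz lef_pV2 ?posrE // ler_nat.
Qed.

Lemma adherent_eq_on_bounded (R : realType) (X : topologicalType) (x0 : X)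
    (Z : set (Cp R X)) (phi : X -> R) (B : nat -> set X) :
  relatively_countably_compact Z -> pointwise_adherent Z phi ->
  (forall j, bounded_in R (B j)) ->
  exists g : Cp R X, forall j x, B j x -> Cp_eval x g = phi x.
Proof.
move=> Zcc Zphi Bbnd; have [u Zu hu] := adherent_sequence x0 B Zphi.
have [g gu] := Zcc u Zu; exists g => j x Bx.
have cts (f : Cp R X) (c : R) : continuous (fun z => Cp_eval z f - c).
  move=> z; apply: cvgB; last exact: cvg_cst.
  exact: (@cts_fun _ _ (f : continuousType X R)).
(* Index 0 encodes [g z = phi x], index [k.+1] encodes [u k z = u k x]. *)
pose a i z := if i is k.+1 then Cp_eval z (u k) - Cp_eval x (u k)
              else Cp_eval z g - phi x.
have [||n e e0|z az] := @bounded_in_common_zero R X (B j) a; first exact: Bbnd.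
- by case=> [|k]; exact: cts.
- have [y [By uy phiy cy]] := hu j x n e Bx e0; exists y => // -[|i] ilt /=.
    (* At such [y] the values [u k y] converge to [phi y] and accumulate at [g y]. *)
    suff -> : Cp_eval y g = phi y by [].
    apply: eq_dist_lt => d d0; have d20 : 0 < d / 2 by lra.
    have [N _ hN] := (cvgrPdist_lt _ _).1 cy _ d20.
    have [k Nk /(_ y (mem_head _ _)) gk] := cluster_Cp_eval [:: y] N gu d20.
    have := hN k Nk; rewrite /= distrC => uk.
    by rewrite (splitr d); apply: le_lt_trans (ler_distD _ _ _) (ltrD gk uk).
  by apply: uy; apply: ltnW.
have gz : Cp_eval z g = phi x by apply/subr0_eq; exact: (az 0%N).
have uz k : Cp_eval z (u k) = Cp_eval x (u k).
  by apply/subr0_eq; exact: (az k.+1).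
rewrite -gz; apply: eq_dist_lt => d d0; have d20 : 0 < d / 2 by lra.
have [k _ hk] := cluster_Cp_eval [:: x; z] 0 gu d20.
have := hk x; have := hk z.
rewrite !inE !eqxx orbT uz => /(_ isT) h1 /(_ isT) h2.
rewrite (splitr d); apply: le_lt_trans (ler_distD (Cp_eval x (u k)) _ _) _.
by rewrite [X in _ + X]distrC; apply: ltrD.
Qed.

(** * Continuity of the limit and compactness *)

Lemma singleton_bounded_in (R : realType) (X : topologicalType) (x : X) :
  bounded_in R [set x].
Proof.
move=> f _; exists `|f x|; split; first exact: num_real.
by move=> M fM _ ->; exact: ltW.
Qed.

Lemma continuous_eq_on_dense (R : realType) (X : topologicalType) (M S : set X)
    (f g : X -> R) : continuous f -> continuous g ->
  dense (set_val @^-1` S : set (set_type M)) ->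
  {in S, f =1 g} -> {in M, f =1 g}.
Proof.
move=> cf cg dS fg x xM; apply/eqP; apply: contrapT => /negP nfg.
pose h y := f y - g y.
have ch : continuous h by move=> y; apply: cvgB; [exact: cf|exact: cg].
pose O : set (set_type M) := set_val @^-1` (h @^-1` [set r | r != 0]).
have oO : open O.
  apply: open_comp => [? _|]; first exact: initial_continuous.
  by apply: open_comp => [? _|]; [exact: ch | exact: open_neq].
have O0 : O !=set0 by exists (SigSub xM); rewrite /O /= subr_eq0.
have [y [Oy Sy]] := dS O O0 oO.
by move: Oy; rewrite /O /= /h fg ?subrr ?eqxx // inE.
Qed.

Lemma adherent_continuous (R : realType) (X : topologicalType)
    (Z : set (Cp R X)) (phi : X -> R) :
  b_sigma_flavoured R X ->
  relatively_countably_compact Z -> pointwise_adherent Z phi -> continuous phi.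
Proof.
(* A copy of [x0] is kept as the base point needed for the sequence. *)
move=> [_ gen] Zcc Zphi x0; move: (x0); apply/gen => M [S [[B Bbnd SB] SM dS]].
have [g gphi] := adherent_eq_on_bounded x0 Zcc Zphi Bbnd.
exists g => //; apply/eq_sigLP => x xM.
(* The point [x] may lie outside [S]; adding it yields a [g'] equal to [phi] at [x] and to [g] on
   [S], hence to [g] on [M]. *)
pose B' n := if n is k.+1 then B k else [set x].
have B'bnd n : bounded_in R (B' n).
  by case: n => [|n]; [exact: singleton_bounded_in | exact: Bbnd].
have [g' g'phi] := adherent_eq_on_bounded x0 Zcc Zphi B'bnd.
have cts (h : Cp R X) : continuous (fun y => Cp_eval y h).
  exact: (@cts_fun _ _ (h : continuousType X R)).
rewrite -(g'phi 0%N x erefl).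
apply: (continuous_eq_on_dense (cts g) (cts g') dS) => //.
by move=> y; rewrite inE SB => -[n _ By]; rewrite (gphi n) // (g'phi n.+1).
Qed.

Theorem theorem8 (R : realType) (X : topologicalType)
    (X_tychonoff : tychonoff_space X) (X_flavoured : b_sigma_flavoured R X) :
  mu_cc_complete R X.
Proof.
move=> Z Zcc; rewrite compact_ultra => F FU FZ.
have /choice[phi hphi] x : exists p : R, Cp_eval x g @[g --> F] --> p.
  have [b hb] := closure_countably_compact_bounded x Zcc.
  by apply: (@ultra_bounded_cvg _ _ _ _ b); exact: filterS FZ.
have Fphi (s : seq X) (e : R) : 0 < e ->
    F [set f | forall x, x \in s -> `|phi x - Cp_eval x f| < e].
  move=> e0; elim: s => [|y s IH]; first by apply: filterS FZ.
  have /cvgrPdist_lt/(_ e e0) H := hphi y.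
  apply: filterS (filterI H IH) => g [hy hs] x.
  by rewrite inE => /predU1P[->|/hs].
have Zphi : pointwise_adherent Z phi.
  (* Half of [e] leads from [phi] to the closure of [Z], half from there to [Z]. *)
  move=> s e e0; have e20 : 0 < e / 2 by lra.
  have [f [fs fZ]] := filter_ex (filterI (Fphi s _ e20) FZ).
  have [g [Zg fg]] := fZ _ (nbhs_Cp_eval f s e20).
  exists g => // x xs; rewrite distrC (splitr e).
  exact: le_lt_trans (ler_distD _ _ _) (ltrD (fs x xs) (fg x xs)).
have cphi := adherent_continuous X_flavoured Zcc Zphi.
pose g : continuousType X R := mkcts cphi.
have Fg : F --> (g : Cp R X) by apply: Cp_cvg.
exists g; split => //.
apply: (@closed_closure _ Z).
by move=> A /Fg FA; have [h [hA hZ]] := filter_ex (filterI FA FZ); exists h.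
Qed.
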